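(* Let $n\geq 2$ be an integer, let $R_n$ be the dihedral quandle of order $n$, and let $f_{b,v}:\mathbb{Z}/n\mathbb{Z}\to\mathbb{Z}/n\mathbb{Z}$, $k\mapsto b+vk$ (with $b\in\mathbb{Z}/n\mathbb{Z}$, $v\in(\mathbb{Z}/n\mathbb{Z})^\times$), be a GL-structure on $R_n$. Let $G$ be the group of GL-rack automorphisms of $(R_n,f_{b,v})$. Then $$G\cong\begin{cases}2\mathbb{Z}/n\mathbb{Z}\rtimes(\mathbb{Z}/n\mathbb{Z})^\times&\text{if }4\mid n\text{ and }v=1+\frac n2,\\ \mathbb{Z}/n\mathbb{Z}\rtimes(\mathbb{Z}/n\mathbb{Z})^\times&\text{otherwise},\end{cases}$$ where $(\mathbb{Z}/n\mathbb{Z})^\times$ acts by multiplication. In the latter case, $G=\operatorname{Aut}R_n$.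
   Context: For a set $X$, $S_X$ is the group of permutations of $X$; products of maps denote composition. A rack is a pair $(X,s)$ of a set $X$ and a map $s:X\to S_X$, $x\mapsto s_x$, such that $s_xs_y=s_{s_x(y)}s_x$ for all $x,y\in X$. A rack homomorphism $(X,s)\to(Y,t)$ is a map $\varphi:X\to Y$ with $\varphi s_x=t_{\varphi(x)}\varphi$ for all $x\in X$, and $\operatorname{Aut}R$ is the group of rack automorphisms of $R$. The dihedral quandle $R_n$ is the rack with underlying set $\mathbb{Z}/n\mathbb{Z}$ and $s_b(a):=2b-a$. It is a known fact that $\operatorname{Aut}R_n$ is the group of all affine transformations $k\mapsto a+uk$ with $a\in\mathbb{Z}/n\mathbb{Z}$, $u\in(\mathbb{Z}/n\mathbb{Z})^\times$. A GL-structure on $R=(X,s)$ is an automorphism $\mathtt{u}\in\operatorname{Aut}R$ such that $\mathtt{u}s_x=s_x\mathtt{u}$ for all $x\in X$; the pair $(R,\mathtt{u})$ is called a GL-rack. A GL-rack automorphism of $(R,\mathtt{u})$ is a rack automorphism $\varphi\in\operatorname{Aut}R$ with $\varphi\mathtt{u}=\mathtt{u}\varphi$. $2\mathbb{Z}/n\mathbb{Z}$ denotes the subgroup $\{2a: a\in\mathbb{Z}/n\mathbb{Z}\}$. *)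

(* Defs.v *)
From HB Require Import structures.
From mathcomp Require Import all_boot all_order all_fingroup all_algebra ring.

Set Implicit Arguments.
Unset Strict Implicit.
Unset Printing Implicit Defensive.

Import GRing.Theory.
Local Open Scope ring_scope.

(* Underlying sets are finite, so that S_X is {perm X}. In {perm X} the
   product s * t means "s first, then t"; equations between products of maps
   are therefore written with \o and =1. *)
Record rack := Rack {
  rack_set :> finType;
  rack_perm : rack_set -> {perm rack_set};
  rack_axiom : forall x y : rack_set,
    rack_perm x \o rack_perm y =1 rack_perm (rack_perm x y) \o rack_perm x
}.

Definition rack_hom (R S : rack) (phi : R -> S) : Prop :=
  forall x : R, phi \o rack_perm x =1 rack_perm (phi x) \o phi.

Definition rack_homb (R S : rack) (phi : R -> S) : bool :=
  [forall x : R, forall y : R,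
     phi (rack_perm x y) == rack_perm (phi x) (phi y)].

Lemma rack_homP (R S : rack) (phi : R -> S) :
  reflect (rack_hom phi) (rack_homb phi).
Proof.
apply: (iffP forallP) => [h x y | h x].
  by move/forallP: (h x) => /(_ y)/eqP.
by apply/forallP=> y; apply/eqP/(h x y).
Qed.

Definition rack_aut (R : rack) : {set {perm R}} :=
  [set phi : {perm R} | rack_homb phi].

Lemma group_set_rack_aut (R : rack) : group_set (rack_aut R).
Proof.
apply/group_setP; split=> [|f g].
  by rewrite inE; apply/rack_homP=> x y /=; rewrite !perm1.
rewrite !inE => /rack_homP hf /rack_homP hg; apply/rack_homP=> x y /=.
by rewrite !permM; have /= -> := hf x y; have /= -> := hg (f x) (f y).
Qed.
Canonical rack_aut_group (R : rack) := Group (group_set_rack_aut R).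

Definition is_GL_structure (R : rack) (u : {perm R}) : Prop :=
  u \in rack_aut R /\ forall x : R, u \o rack_perm x =1 rack_perm x \o u.

Record GL_rack := GLRack {
  GL_rack_base :> rack;
  GL_rack_map : {perm GL_rack_base};
  GL_rack_axiom : is_GL_structure GL_rack_map
}.

Definition GL_rack_aut (Q : GL_rack) : {set {perm Q}} :=
  [set phi in rack_aut Q | (phi * GL_rack_map Q == GL_rack_map Q * phi)%g].

Lemma group_set_GL_rack_aut (Q : GL_rack) : group_set (GL_rack_aut Q).
Proof.
have GLE h : (h \in GL_rack_aut Q)
    = (h \in rack_aut_group Q) && (h * GL_rack_map Q == GL_rack_map Q * h)%g.
  by rewrite [LHS]in_set.
apply/group_setP; split=> [|f g]; rewrite !GLE.
  by rewrite group1 mul1g mulg1 eqxx.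
case/andP=> fA /eqP fu /andP[gA /eqP gu].
by rewrite groupM //= -mulgA gu mulgA fu mulgA.
Qed.
Canonical GL_rack_aut_group (Q : GL_rack) := Group (group_set_GL_rack_aut Q).

(* 'Z_n is the ring Z/nZ only when 1 < n. *)

Definition dihedral_map (n : nat) (b a : 'Z_n) : 'Z_n := 2 * b - a.

Lemma dihedral_map_inj (n : nat) (b : 'Z_n) : injective (dihedral_map b).
Proof. by move=> x y /addrI /oppr_inj. Qed.

Definition dihedral_perm (n : nat) (b : 'Z_n) : {perm 'Z_n} :=
  perm (@dihedral_map_inj n b).

Lemma dihedral_axiom (n : nat) (x y : 'Z_n) :
  dihedral_perm x \o dihedral_perm y
    =1 dihedral_perm (dihedral_perm x y) \o dihedral_perm x.
Proof. by move=> z /=; rewrite !permE /dihedral_map; ring. Qed.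

Definition dihedral_quandle (n : nat) : rack := Rack (@dihedral_axiom n).

Definition affine_map (n : nat) (b : 'Z_n) (v : {unit 'Z_n}) (k : 'Z_n) : 'Z_n :=
  b + val v * k.

Lemma affine_map_inj (n : nat) (b : 'Z_n) (v : {unit 'Z_n}) :
  injective (affine_map b v).
Proof. by move=> x y /addrI; apply: (mulrI (valP v)). Qed.

Definition affine_perm (n : nat) (b : 'Z_n) (v : {unit 'Z_n}) :
    {perm dihedral_quandle n} :=
  perm (@affine_map_inj n b v).

Definition double_Zn (n : nat) : {set 'Z_n} := [set 2 * a | a : 'Z_n].

Lemma group_set_double_Zn (n : nat) : group_set (double_Zn n).
Proof.
apply/group_setP; split=> [|_ _ /imsetP[a _ ->] /imsetP[b _ ->]].
  by apply/imsetP; exists 0; rewrite ?inE ?mulr0.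
by apply/imsetP; exists (a + b); rewrite ?inE ?mulrDr.
Qed.
Canonical double_Zn_group (n : nat) := Group (group_set_double_Zn n).

(* 'U is the action of {unit R} on R by multiplication. *)
Lemma unit_acts_double_Zn (n : nat) :
  {acts [set: {unit 'Z_n}], on group double_Zn n | 'U}.
Proof.
split; last exact: subsetT.
apply/subsetP=> u _; rewrite !inE; apply/subsetP=> _ /imsetP[a _ ->].
by rewrite inE; apply/imsetP; exists (a * val u); rewrite ?inE //= mulrA.
Qed.

Definition Zn_sdprod_units (n : nat) : {group _} :=
  [set: @sdprod_by _ _ _ [set: 'Z_n]%G 'U]%G.

Definition double_Zn_sdprod_units (n : nat) : {group _} :=
  [set: sdprod_by <[unit_acts_double_Zn n]>]%G.

(* Main.v *)
(** An endomorphism of R_n is determined by its values at 0 and 1, so Aut R_n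
    consists of the affine maps, among which f_{b,v} is a GL-structure only if
    2b = 0 and 2(v - 1) = 0.  The map a + u k commutes with f_{b,v} iff
    (u - 1) b = (v - 1) a.  The left side vanishes because 2b = 0 and, when n
    is even, u is odd; so only (v - 1) a = 0 remains.  Either v = 1, or
    v = 1 + n/2 with n even; in the latter case 4 | n because v is odd, and
    the condition says that a is even. *)
Require Import Defs.
From mathcomp Require Import all_boot all_order all_fingroup all_algebra.
From mathcomp Require Import ring zify.

Set Implicit Arguments.
Unset Strict Implicit.
Unset Printing Implicit Defensive.

Import GRing.Theory.
Local Open Scope ring_scope.

Lemma Zn_natr_eq0 (n m : nat) : (1 < n)%N -> (m%:R == 0 :> 'Z_n) = (n %| m)%N.
Proof. by move=> n_gt1; rewrite -val_eqE /= val_Zp_nat. Qed.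

Lemma Zn_double_eq0 (n : nat) (w : 'Z_n) :
  (1 < n)%N -> 2 * w = 0 -> w = 0 \/ (2 %| n)%N /\ w = (n %/ 2)%:R.
Proof.
move=> n_gt1 w2.
have w_lt : (w < n)%N by rewrite -[X in (_ < X)%N]Zp_cast.
have: (n %| 2 * w)%N by rewrite -Zn_natr_eq0 // natrM natr_Zp w2.
(* As [2 * w < 2 * n], the quotient is 0 or 1: these give [w = 0] and [n = 2 * w]. *)
case/dvdnP=> [[|[|q]]] Dw.
- by left; rewrite -[w]natr_Zp (_ : nat_of_ord w = 0%N) //; lia.
- right; have Dn : n = (2 * w)%N by lia.
  by rewrite [X in (X %/ 2)%N]Dn mulKn // natr_Zp [X in (_ %| X)%N]Dn dvdn_mulr.
- nia.
Qed.

Lemma Zn_unit_odd (n : nat) (u : {unit 'Z_n}) :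
  (1 < n)%N -> (2 %| n)%N -> odd (val u).
Proof.
move=> n_gt1 n_even; have := valP u.
rewrite /= -[X in X \is a _]natr_Zp unitZpE // => /(coprime_dvdl n_even).
by rewrite coprime2n.
Qed.

(** If [b] is nonzero, then [n] is even and [u] is odd, so [u - 1] is a multiple of 2 and kills
    [b]. *)
Lemma Zn_unit_fix_2torsion (n : nat) (b : 'Z_n) (u : {unit 'Z_n}) :
  (1 < n)%N -> 2 * b = 0 -> val u * b = b.
Proof.
move=> n_gt1 b2; have [->|[n_even _]] := Zn_double_eq0 n_gt1 b2.
  by rewrite mulr0.
have /= u_odd := Zn_unit_odd u n_gt1 n_even.
rewrite -[X in X * _]natr_Zp -[X in X%:R]odd_double_half u_odd.
by rewrite natrD -muln2 natrM mulrDl -mulrA b2 mulr0 addr0 mul1r.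
Qed.

(** On representatives, cancelling [n/2] in the divisibility of [(n/2) * a] by [n] leaves that of
    [a] by 2. *)
Lemma half_mulr_eq0 (n : nat) (a : 'Z_n) : (1 < n)%N -> (2 %| n)%N ->
  ((n %/ 2)%:R * a == 0) = (a \in double_Zn n).
Proof.
move=> n_gt1 n_even; have Dn : n = (n %/ 2 * 2)%N by rewrite divnK.
apply/idP/imsetP=> [|[c _ ->]]; last first.
  by rewrite mulrA -natrM -Dn pchar_Zp // mul0r.
rewrite -{1}[a]natr_Zp -natrM Zn_natr_eq0 // {1}Dn dvdn_pmul2l; last by lia.
case/dvdnP=> c Da; exists c%:R => //.
by rewrite -natrM mulnC -Da natr_Zp.
Qed.

Lemma affine_perm_GL (n : nat) (b : 'Z_n) (v : {unit 'Z_n}) :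
  is_GL_structure (affine_perm b v) -> 2 * b = 0 /\ 2 * (val v - 1) = 0.
Proof.
case=> _ fGL.
(* Commutation with [s_x], evaluated at 0, reads [b + v * (2 * x) = 2 * x - b]. *)
have E x : 2 * b + 2 * ((val v - 1) * x) = 0.
  have /= := fGL x 0; rewrite !permE /affine_map /dihedral_map => /eqP.
  by rewrite -subr_eq0 => /eqP <- /=; ring.
have b2 : 2 * b = 0 by rewrite -[RHS](E 0) !mulr0 addr0.
by split=> //; rewrite -[RHS](E 1) b2 mulr1 add0r.
Qed.

Lemma rack_aut_dihedral (n : nat) (phi : {perm dihedral_quandle n}) :
  (1 < n)%N ->
  reflect (exists a u, phi = affine_perm a u)
          (phi \in rack_aut (dihedral_quandle n)).
Proof.
move=> n_gt1; rewrite inE; apply: (iffP (rack_homP _)) => [phiM|[a [u ->]] x y].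
  pose psi (k : 'Z_n) : 'Z_n := phi k - phi 0.
  have phiE (x y : 'Z_n) : (phi (2 * x - y) : 'Z_n) = 2 * phi x - phi y.
    by have /= := phiM x y; rewrite !permE.
  have psiN k : psi (- k) = - psi k.
    by rewrite /psi -[- k]add0r -[X in phi (X - _)](mulr0 2) phiE; ring.
  have psi2 k : psi (k + 2) = psi k + 2 * psi 1.
    rewrite /psi (_ : k + 2 = 2 * 1 - (- k)); last by ring.
    by have := psiN k; rewrite phiE /psi => /(canRL (subrK _)) ->; ring.
  (* The recurrence [psi2] advances by 2, so the induction carries two consecutive values. *)
  have psiE2 m : psi m%:R = m%:R * psi 1 /\ psi m.+1%:R = m.+1%:R * psi 1.
    elim: m => [|m [IH1 IH2]]; first by rewrite /psi subrr mul0r mul1r.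
    split=> //; rewrite (_ : m.+2%:R = m%:R + 2) ?psi2 ?IH1 ?mulrDl //.
    by rewrite -natrD addn2.
  have psiE k : psi k = k * psi 1 by rewrite -[k]natr_Zp; case: (psiE2 k).
  have psi_unit : psi 1 \is a GRing.unit.
    (* This [k] satisfies [psi k = 1]; as [psi k = k * psi 1], it is the inverse of [psi 1]. *)
    apply/unitrPr; pose k : 'Z_n := (phi^-1)%g (phi 0 + 1 : 'Z_n).
    exists k; rewrite mulrC -psiE /psi /k permKV; ring.
  exists (phi 0), (FinRing.unit 'Z_n psi_unit); apply/permP=> k.
  by rewrite permE /affine_map /= mulrC -psiE /psi addrC subrK.
by rewrite /= !permE /affine_map /dihedral_map /=; ring.
Qed.

Lemma affine_perm_inj (n : nat) (a a' : 'Z_n) (u u' : {unit 'Z_n}) :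
  affine_perm a u = affine_perm a' u' -> a = a' /\ u = u'.
Proof.
move=> /permP E; have := E 0; rewrite !permE /affine_map !mulr0 !addr0 => Ea.
split=> //; apply: val_inj; have := E 1; rewrite !permE /affine_map !mulr1 Ea.
exact: addrI.
Qed.

Lemma affine_permM (n : nat) (a b : 'Z_n) (u v : {unit 'Z_n}) :
  (affine_perm a u * affine_perm b v)%g = affine_perm (a * val v + b) (u * v)%g.
Proof. by apply/permP=> k; rewrite permM !permE /affine_map /=; ring. Qed.

(** The linear parts commute, so only the translation parts [a * v + b] and [b * u + a] need
    comparing. *)
Lemma affine_perm_commute (n : nat) (a b : 'Z_n) (u v : {unit 'Z_n}) :
  (affine_perm a u * affine_perm b v == affine_perm b v * affine_perm a u)%g
    = ((val v - 1) * a == (val u - 1) * b).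
Proof.
rewrite !affine_permM; apply/eqP/eqP => [/affine_perm_inj[E _]|E].
  by move/eqP: E; rewrite -subr_eq0 => /eqP E; apply/subr0_eq; rewrite -E; ring.
congr affine_perm; last by apply: val_inj; rewrite /= mulrC.
by apply/subr0_eq; move/eqP: E; rewrite -subr_eq0 => /eqP <- /=; ring.
Qed.

(** Serves both cases of the theorem, with [H] the even classes or all of ['Z_n]. Permutations
    compose left to right, so the translation part [x * val v + y] of a product is exactly that of
    the semidirect product for a right action; hence pairs [(u, x)] map multiplicatively to affine
    permutations. *)
Lemma affine_isog_sdprod (n : nat) (H : {group 'Z_n})
    (to : groupAction [set: {unit 'Z_n}] H) (G : {group {perm 'Z_n}}) :
  {in H, forall x u, to x u = x * val u} ->
  G = [set affine_perm p.2 p.1 | p in setX [set: {unit 'Z_n}] H] :> {set _} ->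
  G \isog [set: sdprod_by to].
Proof.
move=> toE defG; rewrite isog_sym.
pose f (s : sdprod_by to) := affine_perm (val s).2 (val s).1.
have fM : {in [set: sdprod_by to] &, {morph f : s t / (s * t)%g}}.
  case=> [[u x] /= ux] [[v y] /= vy] _ _; rewrite /f affine_permM /=.
  by rewrite toE //; case/setXP: ux.
apply/isogP; exists (Morphism fM).
  apply/injmP=> s t _ _ /= /affine_perm_inj[E2 E1]; apply: val_inj.
  by rewrite [val s]surjective_pairing E1 E2 -surjective_pairing.
rewrite morphimEdom defG; apply/setP=> p; apply/imsetP/imsetP => [[s _ ->]|[q qH ->]].
  by exists (val s) => //; apply: (valP s).
by exists (SdPair to qH).
Qed.

(** Since [2 * b = 0], every unit fixes [b]; commuting with [affine_perm b v] thus constrains [a]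
    alone and leaves [u] free. *)
Lemma mem_GL_rack_aut_dihedral (n : nat) (b : 'Z_n) (v : {unit 'Z_n})
    (fGL : is_GL_structure (affine_perm b v)) (phi : {perm 'Z_n}) :
  (1 < n)%N ->
  reflect (exists2 a, (val v - 1) * a = 0 & exists u, phi = affine_perm a u)
          (phi \in GL_rack_aut (GLRack fGL)).
Proof.
move=> n_gt1; have [b2 _] := affine_perm_GL fGL.
have comE a u : (affine_perm a u * affine_perm b v
    == affine_perm b v * affine_perm a u)%g = ((val v - 1) * a == 0).
  rewrite affine_perm_commute [in X in _ == X]mulrBl mul1r.
  by rewrite [val u * b]Zn_unit_fix_2torsion // subrr.
rewrite inE; apply: (iffP andP) => [[/rack_aut_dihedral[//|a [u ->]]]|].
  by rewrite comE => /eqP va; exists a => //; exists u.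
case=> a va [u ->]; split; first by apply/rack_aut_dihedral => //; exists a, u.
by rewrite comE va.
Qed.

Theorem proposition4p15 (n : nat) (n_ge2 : (2 <= n)%N)
    (b : 'Z_n) (v : {unit 'Z_n})
    (fGL : is_GL_structure (affine_perm b v)) :
  let G := GL_rack_aut (GLRack fGL) in
  let exceptional := (4 %| n)%N /\ val v = 1 + (n %/ 2)%:R in
  (exceptional -> G \isog double_Zn_sdprod_units n) /\
  (~ exceptional ->
     G \isog Zn_sdprod_units n /\ G = rack_aut (dihedral_quandle n)).
Proof.
move=> G exceptional; split=> [[n4 Dv]|not_exc].
  have n_even : (2 %| n)%N by apply: dvdn_trans n4.
  apply: (@affine_isog_sdprod n (double_Zn_group n) _
            (GL_rack_aut_group (GLRack fGL))) => [x Hx u|].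
    by rewrite actbyE ?inE.
  apply/setP=> phi; apply/mem_GL_rack_aut_dihedral/imsetP => //.
    case=> a; rewrite Dv addrAC subrr add0r => /eqP.
    rewrite half_mulr_eq0 // => Ha [u ->].
    by exists (u, a); rewrite // inE /= Ha inE.
  case=> [[u a] /setXP[_ Ha] ->]; exists a; last by exists u.
  by rewrite Dv addrAC subrr add0r; apply/eqP; rewrite half_mulr_eq0.
have v1 : val v - 1 = 0.
  have [_ /Zn_double_eq0[//|//|[n_even Dv]]] := affine_perm_GL fGL.
  have {}Dv : val v = 1 + (n %/ 2)%:R by rewrite -Dv addrC subrK.
  (* Reduction modulo the even [n] preserves parity, so [1 + n/2] is odd like the unit [v]; hence
     [n/2] is even and 4 divides [n]. *)
  case: not_exc; split=> //; have := Zn_unit_odd v n_ge2 n_even.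
  rewrite Dv nat1r val_Zp_nat // odd_mod; last by lia.
  lia.
have defG : G = rack_aut (dihedral_quandle n).
  apply/setP=> phi; apply/mem_GL_rack_aut_dihedral/rack_aut_dihedral => //.
    by case=> a _ [u ->]; exists a, u.
  by case=> a [u ->]; exists a; [rewrite v1 mul0r | exists u].
split=> //; apply: (@affine_isog_sdprod n [set: 'Z_n]%G _
  (GL_rack_aut_group (GLRack fGL))) => //=.
rewrite [LHS]defG; apply/setP=> phi; apply/rack_aut_dihedral/imsetP => //.
  by case=> a [u ->]; exists (u, a); rewrite ?inE.
by case=> [[u a] _ ->]; exists a, u.
Qed.
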